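(* Let $r\in\mathbb{N}\cup\{0\}$. There exists a constant $D_r>0$, depending only on $r$, such that for all real $p,q$ with $0<q<p\le 1$, all $n\in\mathbb{N}$, all $x\in[0,1]$ and every $f\in C^r[0,1]$, $$\left|B_{n,p,q}^{[r]}(f;x)-f(x)\right|\le D_r\,\frac{1}{[n]^{r/2}}\;\omega\!\left(f^{(r)};\frac{1}{\sqrt{[n]}}\right).$$
   Context: For $0<q<p\le1$ and integers $n\ge0$, $[n]=[n]_{p,q}=\frac{p^n-q^n}{p-q}$, $[n]!=[n]_{p,q}!=\prod_{j=1}^n[j]$ (with $[0]!=1$), and $\left[{n\atop k}\right]_{p,q}=\frac{[n]!}{[k]!\,[n-k]!}$. Put $$P_{n,k}(p,q;x)=p^{\frac{k(k-1)}{2}}\left[{n\atop k}\right]_{p,q}x^k\prod_{s=0}^{n-k-1}(p^s-q^sx).$$ For $r\in\mathbb{N}\cup\{0\}$ and $f\in C^r[0,1]$ ($r$ times continuously differentiable functions, $f^{(0)}=f$), the $r$-th order $(p,q)$-Bernstein operator is $$B_{n,p,q}^{[r]}(f;x)=\frac{1}{p^{\frac{n(n-1)}{2}}}\sum_{k=0}^n P_{n,k}(p,q;x)\sum_{i=0}^r\frac{1}{i!}f^{(i)}\!\left(\frac{[k]}{p^{k-n}[n]}\right)\left(x-\frac{[k]}{p^{k-n}[n]}\right)^i .$$ The modulus of continuity is $\omega(g;t)=\sup\{|g(x)-g(y)|:\ |x-y|\le t,\ x,y\in[0,1]\}$. *)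

(* Defs.v *)
From HB Require Import structures.
From mathcomp Require Import all_boot all_order all_algebra.
From mathcomp Require Import all_classical all_reals all_analysis.

Set Implicit Arguments.
Unset Strict Implicit.
Unset Printing Implicit Defensive.

Import Order.TTheory GRing.Theory Num.Theory.
Import numFieldTopology.Exports numFieldNormedType.Exports.

Local Open Scope classical_set_scope.
Local Open Scope ring_scope.

Section PQCalculus.
Variable R : realType.
Implicit Types (p q x : R) (n k : nat).

Definition pq_int p q n : R := (p ^+ n - q ^+ n) / (p - q).

Definition pq_fact p q n : R := \prod_(1 <= j < n.+1) pq_int p q j.

(* Meaningful only for k <= n, because of the truncated subtraction. *)
Definition pq_binom p q n k : R :=
  pq_fact p q n / (pq_fact p q k * pq_fact p q (n - k)).

Definition pq_basis n k p q x : R :=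
  p ^+ (k * k.-1)./2 * pq_binom p q n k * x ^+ k *
  \prod_(0 <= s < n - k) (p ^+ s - q ^+ s * x).

(* The exponent k - n is an integer, nonpositive in the operator below. *)
Definition pq_node n k p q : R :=
  pq_int p q k / (p ^ (k%:Z - n%:Z) * pq_int p q n).

End PQCalculus.

Section UnitInterval.
Variable R : realType.
Implicit Types (f g : R -> R) (r i : nat) (x t : R).

(* Functions on [0, 1] are represented by functions R -> R of which only the
   restriction to [0, 1] matters: difference quotients are taken at points of
   [0, 1] only, so that derivatives at 0 and 1 are one-sided. *)
Definition diff_quotient f x : R -> R := fun y => (f y - f x) / (y - x).

Definition derivable01 f x : Prop :=
  cvg (diff_quotient f x @ within `[0, 1] x^').

Definition derive01 f : R -> R :=
  fun x => lim (diff_quotient f x @ within `[0, 1] x^').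

Definition derive01n i f : R -> R := iter i derive01 f.

(* Continuity of the derivatives of order < r follows from their
   differentiability. *)
Definition Cr01 r f : Prop :=
  (forall i, (i < r)%N -> forall x, x \in `[0, 1] ->
     derivable01 (derive01n i f) x) /\
  {within `[0, 1], continuous (derive01n r f)}.

(* The set is bounded for t >= 0 whenever g is continuous on [0, 1], so that
   the real-valued supremum is the true one. *)
Definition modulus g t : R :=
  sup [set d | exists x y : R,
    [/\ x \in `[0, 1], y \in `[0, 1], `|x - y| <= t & d = `|g x - g y|]].

End UnitInterval.

Definition pq_bernstein (R : realType) (r n : nat) (p q : R) (f : R -> R)
    (x : R) : R :=
  (p ^+ (n * n.-1)./2)^-1 *
  \sum_(0 <= k < n.+1) pq_basis n k p q x *
    \sum_(0 <= i < r.+1) (i`!%:R)^-1 * derive01n i f (pq_node n k p q) *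
      (x - pq_node n k p q) ^+ i.

(* Main.v *)
Require Import Defs.
From mathcomp Require Import all_boot all_order all_algebra.
From mathcomp Require Import ring lra zify.
From mathcomp Require Import all_classical all_reals all_analysis.

(* With u = q / p, all powers of p cancel and the operator becomes the
   u-Bernstein operator, while [n]_{p,q} = p^(n-1) [n]_u <= [n]_u, so that one
   may assume p = 1.

   By Taylor's formula at the node t and the growth of the modulus, the error at
   x is at most |x - t|^r (1 + |x - t| / s) w(f^(r); s) averaged over the nodes,
   where s = [n]_u^(-1/2); so it suffices that the moment M_m of order m of the
   u-Bernstein weights is O(s^m), uniformly in u and n, for the even orders
   2r and 2r+2.  The weights satisfy
     (1 - x) (w_k(x) - w_k(ux)) = (1 - u) [n]_u (t_k - x) w_k(x),
   which gives a recursion for M_m as a polynomial in x.  It only involves the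
   u-difference quotient of M_m and products M_j (1 - u)^(m-j-1), where
   1 - u <= s^2, and the l1 norm of coefficients is well behaved under all
   these operations. *)

Import Order.TTheory GRing.Theory Num.Theory.
Import numFieldNormedType.Exports.

Set Implicit Arguments.
Unset Strict Implicit.
Unset Printing Implicit Defensive.

Local Open Scope ring_scope.

Lemma pq_factS (R : realType) (a b : R) n :
  pq_fact a b n.+1 = pq_fact a b n * pq_int a b n.+1.
Proof. by rewrite /pq_fact big_nat_recr. Qed.

(** * Removing [p] by scaling *)

Section Reduction.
Context {R : realType}.
Variables p q : R.
Hypotheses (p0 : p != 0) (pq : p - q != 0).

(** The factor [p ^+ n / p] is p^(n-1), in a form that covers [n = 0] too. *)
Lemma pq_int_scale n : pq_int p q n = p ^+ n / p * pq_int 1 (q / p) n.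
Proof.
rewrite /pq_int expr1n expr_div_n.
have ? : 1 - q / p != 0 by rewrite -(divff p0) -mulrBl mulf_neq0 ?invr_neq0.
by field; rewrite pq p0 expf_neq0.
Qed.

Lemma pq_fact_scale n : pq_fact p q n = p ^+ 'C(n, 2) * pq_fact 1 (q / p) n.
Proof.
elim: n => [|n IHn]; first by rewrite /pq_fact !big_geq ?mul1r.
rewrite !pq_factS IHn pq_int_scale binS bin1 exprD exprSr.
by field; rewrite p0.
Qed.

(** The exponents of [p] are C(k,2) in the prefactor, C(n,2) - C(k,2) - C(n-k,2) in the binomial
    coefficient and C(n-k,2) in the product. They add up to C(n,2), which the normalisation
    removes. *)
Lemma pq_basis_scale n k x :
  (p ^+ (n * n.-1)./2)^-1 * pq_basis n k p q x = pq_basis n k 1 (q / p) x.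
Proof.
have prod_scale m : \prod_(0 <= s < m) (p ^+ s - q ^+ s * x) =
    p ^+ 'C(m, 2) * \prod_(0 <= s < m) (1 ^+ s - (q / p) ^+ s * x).
  elim: m => [|m IHm]; first by rewrite !big_geq ?mul1r.
  rewrite !big_nat_recr //= IHm binS bin1 exprD expr1n expr_div_n.
  by field; rewrite expf_neq0.
rewrite /pq_basis /pq_binom !pq_fact_scale prod_scale -!bin2 expr1n.
set a := p ^+ 'C(n, 2); set b := p ^+ 'C(k, 2); set c := p ^+ _.
have ? : a != 0 by rewrite expf_neq0.
have ? : b != 0 by rewrite expf_neq0.
have ? : c != 0 by rewrite expf_neq0.
rewrite !invfM; set A := (pq_fact _ _ k)^-1; set B := (pq_fact _ _ _)^-1.
by field; apply/and3P.
Qed.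

Lemma pq_node_scale n k : pq_node n k p q = pq_node n k 1 (q / p).
Proof.
rewrite /pq_node !pq_int_scale expfzDr // exp1rz mul1r -invr_expz -!exprnP.
move: (pq_int _ _ n) (pq_int _ _ k) => N K; rewrite !invfM invrK.
by move: N^-1 => V; field; rewrite p0 !expf_neq0.
Qed.

Lemma pq_bernstein_scale r n f x :
  pq_bernstein r n p q f x = pq_bernstein r n 1 (q / p) f x.
Proof.
rewrite /pq_bernstein expr1n invr1 mul1r mulr_sumr.
by apply: eq_bigr => k _; rewrite mulrA pq_basis_scale pq_node_scale.
Qed.

End Reduction.

(** * Weights, nodes and central moments for p = 1 *)

Section QBernstein.
Context {R : realType}.
Variable u : R.
Hypotheses (u0 : 0 < u) (u1 : u < 1).

Local Notation qint := (pq_int 1 u).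
Local Notation w n k x := (pq_basis n k 1 u x).

Let u1B : 1 - u != 0.
Proof. by rewrite subr_eq0 gt_eqF. Qed.

Lemma qintE n : (1 - u) * qint n = 1 - u ^+ n.
Proof. by rewrite /pq_int expr1n mulrC divfK. Qed.

Lemma qint0 : qint 0 = 0.
Proof. by apply: (mulfI u1B); rewrite qintE expr0 subrr mulr0. Qed.

Lemma qintS n : qint n.+1 = 1 + u * qint n.
Proof. by apply: (mulfI u1B); rewrite qintE mulrDr (mulrCA _ u) !qintE exprS; ring. Qed.

Lemma qint_ge0 n : 0 <= qint n.
Proof.
elim: n => [|n IHn]; first by rewrite qint0.
by rewrite qintS addr_ge0 // mulr_ge0 // ltW.
Qed.

Lemma qint_ge1 n : 1 <= qint n.+1.
Proof. by rewrite qintS lerDl mulr_ge0 ?qint_ge0 // ltW. Qed.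

Lemma qint_le n k : (k <= n)%N -> qint k <= qint n.
Proof.
move=> kn; rewrite -(@ler_pM2l _ (1 - u)) ?subr_gt0 // !qintE lerD2l lerN2.
by apply: ler_wiXn2l => //; exact: ltW.
Qed.

Lemma qint_le_natr n : qint n <= n%:R.
Proof.
elim: n => [|n IHn]; first by rewrite qint0.
rewrite qintS -[in leRHS]add1n natrD lerD2l (le_trans _ IHn) //.
by rewrite ler_piMl ?qint_ge0 // ltW.
Qed.

(** Since (1 - u) [n+1] = 1 - u^(n+1) <= 1. In the moment recursion each factor [1 - u] thereby
    counts as s^2. *)
Lemma subr1_le_invqint n : 1 - u <= (qint n.+1)^-1.
Proof.
rewrite -[leRHS]mul1r ler_pdivlMr; last exact: (lt_le_trans ltr01 (qint_ge1 n)).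
by rewrite qintE lerBlDr lerDl exprn_ge0 // ltW.
Qed.

Lemma qfact_gt0 n : 0 < pq_fact 1 u n.
Proof.
elim: n => [|n IHn]; first by rewrite /pq_fact big_geq.
by rewrite pq_factS mulr_gt0 // (lt_le_trans ltr01 (qint_ge1 n)).
Qed.

Lemma qbinom0 n : pq_binom 1 u n 0 = 1.
Proof.
rewrite /pq_binom subn0 {2}/pq_fact big_geq // mul1r divff //.
by rewrite gt_eqF ?qfact_gt0.
Qed.

Lemma qbinomnn n : pq_binom 1 u n n = 1.
Proof.
rewrite /pq_binom subnn {3}/pq_fact big_geq // mulr1 divff //.
by rewrite gt_eqF ?qfact_gt0.
Qed.

(** The u-Pascal rule, from [n+1] = [k+1] + u^(k+1) [n-k]. *)
Lemma qbinomS n k : (k < n)%N -> pq_binom 1 u n.+1 k.+1 =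
  pq_binom 1 u n k + u ^+ k.+1 * pq_binom 1 u n k.+1.
Proof.
move=> kn; rewrite /pq_binom subSS -(subnSK kn) !pq_factS.
set m := (n - k.+1)%N.
have -> : pq_int 1 u n.+1 = pq_int 1 u k.+1 + u ^+ k.+1 * pq_int 1 u m.+1.
  apply: (mulfI u1B); rewrite mulrDr (mulrCA _ (u ^+ _)) !qintE mulrBr -exprD.
  by rewrite addnS subnKC //; ring.
have f0 j : pq_fact 1 u j != 0 by rewrite gt_eqF ?qfact_gt0.
have i0 j : pq_int 1 u j.+1 != 0.
  by rewrite gt_eqF // (lt_le_trans ltr01 (qint_ge1 j)).
move: (f0 k) (f0 m) (i0 k) (i0 m).
move: (pq_fact _ _ k) (pq_fact _ _ m) (pq_fact _ _ n) => Fk Fm Fn.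
move: (pq_int _ _ k.+1) (pq_int _ _ m.+1) => ik im *.
by field; apply/and4P.
Qed.

(** Dilating [x] by [u] turns each factor into the next one; [1 - x] supplies the missing first
    factor. *)
Lemma qpoch_dilate m x : (1 - x) * \prod_(0 <= s < m) (1 ^+ s - u ^+ s * (u * x))
  = \prod_(0 <= s < m.+1) (1 ^+ s - u ^+ s * x).
Proof.
rewrite big_nat_recl // expr0 mul1r; congr (_ * _).
by apply: eq_bigr => s _; rewrite !expr1n exprSr mulrA.
Qed.

Lemma qbasisE n k x : w n k x = pq_binom 1 u n k * x ^+ k *
  \prod_(0 <= s < n - k) (1 ^+ s - u ^+ s * x).
Proof. by rewrite /pq_basis expr1n mul1r. Qed.

Lemma qbasis_ge0 n k x : 0 <= x -> x <= 1 -> 0 <= w n k x.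
Proof.
move=> x0 x1; rewrite qbasisE mulr_ge0 //.
  by rewrite mulr_ge0 ?exprn_ge0 // divr_ge0 ?mulr_ge0 // ltW ?qfact_gt0.
apply: prodr_ge0 => s _; rewrite expr1n subr_ge0 mulr_ile1 ?exprn_ge0 ?(ltW u0) //.
by rewrite exprn_ile1 ?ltW.
Qed.

Lemma sum_qbasis n x : \sum_(0 <= k < n.+1) w n k x = 1.
Proof.
elim: n x => [|n IHn] x.
  by rewrite big_nat1 qbasisE qbinom0 big_geq // mulr1 mul1r.
(* The u-Pascal rule on weights. One term sits at [u * x], so the induction hypothesis is kept for
   all [x]. *)
have qbasisS k : (k < n)%N ->
    w n.+1 k.+1 x = x * w n k x + (1 - x) * w n k.+1 (u * x).
  move=> kn; rewrite !qbasisE qbinomS // (mulrCA (1 - x)) qpoch_dilate.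
  by rewrite subSS -(subnSK kn) !exprS exprMn; ring.
rewrite big_nat_recl // big_nat_recr //=.
have -> : w n.+1 0 x = (1 - x) * w n 0 (u * x).
  by rewrite !qbasisE mulrCA qpoch_dilate !subn0 !qbinom0.
have -> : w n.+1 n.+1 x = x * w n n x.
  by rewrite !qbasisE !subnn !qbinomnn exprS; ring.
under eq_big_nat => k /andP[_ kn] do rewrite qbasisS //.
rewrite big_split /= -!mulr_sumr.
transitivity (x * \sum_(0 <= k < n.+1) w n k x +
              (1 - x) * \sum_(0 <= k < n.+1) w n k (u * x)).
  rewrite [\sum_(0 <= k < n.+1) w n k x]big_nat_recr //=.
  by rewrite [\sum_(0 <= k < n.+1) w n k (u * x)]big_nat_recl //=; ring.
by rewrite !IHn; ring.
Qed.

Lemma qnodeE n k : pq_node n k 1 u = qint k / qint n.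
Proof. by rewrite /pq_node exp1rz mul1r. Qed.

(* The q-analogue of [x (1 - x) P' = n (t - x) P] for the Bernstein basis. *)
Lemma qbasis_qdiff n k x : (0 < n)%N -> (k <= n)%N ->
  (1 - x) * (w n k x - w n k (u * x)) =
  (1 - u) * qint n * (pq_node n k 1 u - x) * w n k x.
Proof.
case: n => // n _ kn; rewrite mulrBr !qbasisE.
(* Both sides now share a common factor, and what remains is (1 - x) - u^k (1 - u^(n-k) x) = (1 -
   u^k) - (1 - u^n) x. *)
rewrite [X in _ - X]mulrCA qpoch_dilate big_nat_recr //= expr1n exprMn qnodeE.
have -> : (1 - u) * qint n.+1 * (qint k / qint n.+1 - x) =
    (1 - u) * qint k - (1 - u) * qint n.+1 * x.
  by field; rewrite gt_eqF // (lt_le_trans ltr01 (qint_ge1 n)).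
rewrite !qintE -[in u ^+ n.+1](subnKC kn) exprD.
ring.
Qed.

Definition qmoment n m x : R :=
  \sum_(0 <= k < n.+1) w n k x * (pq_node n k 1 u - x) ^+ m.

Lemma qmoment0 n x : qmoment n 0 x = 1.
Proof. by rewrite -[RHS](sum_qbasis n x); apply: eq_bigr => k _; rewrite mulr1. Qed.

(** Multiply [qbasis_qdiff] by the m-th power of t_k - x and sum over k. The sum with dilated
    weights is centred at [x] instead of [u * x]; recentring it by the binomial theorem brings in
    the lower moments. *)
Lemma qmomentS n m x : (0 < n)%N ->
  qmoment n m.+1 x = (1 - x) / qint n *
   ((qmoment n m x - qmoment n m (u * x)) / (1 - u) -
    \sum_(j < m) (- x) ^+ (m - j) * (1 - u) ^+ (m - j).-1 *
       qmoment n j (u * x) *+ 'C(m, j)).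
Proof.
move=> n0.
have dilated : \sum_(0 <= k < n.+1) w n k (u * x) * (pq_node n k 1 u - x) ^+ m =
    qmoment n m (u * x) + (1 - u) * \sum_(j < m) (- x) ^+ (m - j) *
      (1 - u) ^+ (m - j).-1 * qmoment n j (u * x) *+ 'C(m, j).
  transitivity (\sum_(j < m.+1) (- x) ^+ (m - j) *
      (1 - u) ^+ (m - j) * qmoment n j (u * x) *+ 'C(m, j)).
    under [RHS]eq_bigr => j _ do rewrite /qmoment mulr_sumr -sumrMnl.
    rewrite [RHS]exchange_big /=; apply: eq_bigr => k _.
    have -> : pq_node n k 1 u - x = (- x) * (1 - u) + (pq_node n k 1 u - u * x).
      by ring.
    rewrite exprDn mulr_sumr; apply: eq_bigr => j _.
    by rewrite exprMn mulrnAr; congr (_ *+ _); ring.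
  (* The term j = m has no factor [1 - u] and joins the difference quotient; every other term gives
     up one such factor. *)
  rewrite big_ord_recr /= subnn !expr0 !mul1r binn mulr1n addrC; congr (_ + _).
  rewrite mulr_sumr; apply: eq_bigr => j _.
  rewrite mulrnAr; congr (_ *+ _).
  have -> : (1 - u) ^+ (m - j) = (1 - u) * (1 - u) ^+ (m - j).-1.
    by rewrite -exprS prednK ?subn_gt0.
  by ring.
have N0 : qint n != 0.
  by case: n n0 {dilated} => // n _; rewrite gt_eqF // (lt_le_trans ltr01 (qint_ge1 n)).
apply: (mulfI (mulf_neq0 u1B N0)).
transitivity ((1 - x) * (qmoment n m x - \sum_(0 <= k < n.+1) w n k (u * x) *
    (pq_node n k 1 u - x) ^+ m)); last by rewrite dilated; field; apply/andP.
rewrite /qmoment -sumrB !mulr_sumr; apply: eq_big_nat => k /andP[_ kn].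
rewrite -mulrBl [in RHS]mulrA qbasis_qdiff // exprS. ring.
Qed.

End QBernstein.

(** * Coefficient bounds and the size of the moments *)

Section PolynomialBound.
Context {R : realType}.
Implicit Types (A B a u : R) (M : R -> R) (d : nat).

(** The l1 norm of coefficients, unlike the sup norm on [0, 1], bounds the u-difference quotient
    term by term. The degree is recorded because that quotient costs a factor [d]. *)
Definition poly_bound d A M := exists c : nat -> R,
  \sum_(0 <= i < d.+1) `|c i| <= A /\
  forall x, M x = \sum_(0 <= i < d.+1) c i * x ^+ i.

Lemma poly_bound_ext d A M M' : M =1 M' -> poly_bound d A M -> poly_bound d A M'.
Proof. by move=> e [c [cA cM]]; exists c; split=> // x; rewrite -e. Qed.

Lemma poly_bound_le d A B M : A <= B -> poly_bound d A M -> poly_bound d B M.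
Proof. by move=> AB [c [cA cM]]; exists c; split=> //; exact: le_trans cA AB. Qed.

Lemma poly_bound1 : poly_bound 0 1 (fun=> 1).
Proof.
by exists (fun=> 1); split=> [|x]; rewrite big_nat1 ?normr1 // expr0 mulr1.
Qed.

Lemma poly_bound0 d : poly_bound d 0 (fun=> 0).
Proof.
exists (fun=> 0); split=> [|x]; rewrite big1 // => i _; first by rewrite normr0.
by rewrite mul0r.
Qed.

Lemma poly_boundS d A M : poly_bound d A M -> poly_bound d.+1 A M.
Proof.
(* [c] is arbitrary beyond index [d], so it is cut off there. *)
move=> [c [cA cM]]; exists (fun i => if (i <= d)%N then c i else 0).
split=> [|x]; rewrite big_nat_recr //= ltnn ?normr0 ?mul0r addr0 ?cM.
  by rewrite (le_trans _ cA) // le_eqVlt; apply/orP; left; apply/eqP;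
    apply: eq_big_nat => i; rewrite ltnS => /andP[_ ->].
by apply: eq_big_nat => i; rewrite ltnS => /andP[_ ->].
Qed.

Lemma poly_boundD d A B M M' : poly_bound d A M -> poly_bound d B M' ->
  poly_bound d (A + B) (fun x => M x + M' x).
Proof.
move=> [c [cA cM]] [c' [cB cM']]; exists (fun i => c i + c' i); split=> [|x].
  apply: le_trans (lerD cA cB); rewrite -big_split /=.
  by apply: ler_sum => i _; exact: ler_normD.
by rewrite cM cM' -big_split /=; apply: eq_bigr => i _; rewrite mulrDl.
Qed.

Lemma poly_boundZ d a A M : poly_bound d A M ->
  poly_bound d (`|a| * A) (fun x => a * M x).
Proof.
move=> [c [cA cM]]; exists (fun i => a * c i); split=> [|x].
  under eq_bigr do rewrite normrM.
  by rewrite -mulr_sumr ler_wpM2l.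
by rewrite cM mulr_sumr; apply: eq_bigr => i _; rewrite mulrA.
Qed.

Lemma poly_boundN d A M : poly_bound d A M -> poly_bound d A (fun x => - M x).
Proof.
move=> /(poly_boundZ (-1)); rewrite normrN1 mul1r.
by apply: poly_bound_ext => x; rewrite mulN1r.
Qed.

Lemma poly_boundX d A M : poly_bound d A M -> poly_bound d.+1 A (fun x => x * M x).
Proof.
move=> [c [cA cM]]; exists (fun i => if i is j.+1 then c j else 0).
split=> [|x]; rewrite big_nat_recl //= ?normr0 ?mul0r add0r //.
by rewrite cM mulr_sumr; apply: eq_bigr => i _; rewrite exprS mulrCA.
Qed.

Lemma poly_boundXn k d A M : poly_bound d A M ->
  poly_bound (k + d) A (fun x => (- x) ^+ k * M x).
Proof.
move=> bM; elim: k => [|k /poly_boundX/poly_boundN].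
  by apply: poly_bound_ext bM => x; rewrite mul1r.
by apply: poly_bound_ext => x; rewrite exprS; ring.
Qed.

Lemma poly_bound_sum m d (A : nat -> R) (F : nat -> R -> R) :
  (forall j, (j < m)%N -> poly_bound d (A j) (F j)) ->
  poly_bound d (\sum_(j < m) A j) (fun x => \sum_(j < m) F j x).
Proof.
elim: m => [|m IHm] bF.
  rewrite big_ord0; apply: poly_bound_ext (poly_bound0 d) => x.
  by rewrite big_ord0.
rewrite big_ord_recr /=.
have := poly_boundD (IHm (fun j jm => bF j (ltnW jm))) (bF m (ltnSn m)).
by apply: poly_bound_ext => x; rewrite big_ord_recr.
Qed.

Lemma poly_bound_dilate u d A M : 0 < u -> u < 1 -> poly_bound d A M ->
  poly_bound d A (fun x => M (u * x)).
Proof.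
move=> u0 u1 [c [cA cM]]; exists (fun i => c i * u ^+ i); split=> [|x].
  apply: le_trans cA; apply: ler_sum => i _.
  rewrite normrM ler_piMr // ger0_norm ?exprn_ge0 ?(ltW u0) //.
  by rewrite exprn_ile1 ?ltW.
by rewrite cM; apply: eq_bigr => i _; rewrite exprMn mulrA.
Qed.

(** The quotient sends x^i to [i]_u x^i, and [i]_u <= i <= d. There is no division by [x], so the
    degree does not drop. *)
Lemma poly_bound_qdiff u d A M : 0 < u -> u < 1 -> poly_bound d A M ->
  poly_bound d (d%:R * A) (fun x => (M x - M (u * x)) / (1 - u)).
Proof.
move=> u0 u1 [c [cA cM]]; exists (fun i => pq_int 1 u i * c i); split=> [|x].
  apply: (le_trans (y := d%:R * \sum_(0 <= i < d.+1) `|c i|)).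
    rewrite mulr_sumr; apply: ler_sum_nat => i; rewrite ltnS => /andP[_ id].
    rewrite normrM ler_wpM2r // ger0_norm ?qint_ge0 //.
    by rewrite (le_trans (qint_le_natr u0 u1 i)) // ler_nat.
  by rewrite ler_wpM2l.
rewrite !cM -sumrB mulr_suml; apply: eq_bigr => i _.
by rewrite /pq_int expr1n exprMn; ring.
Qed.

Lemma poly_bound_norm_le d A M x : 0 <= x -> x <= 1 -> poly_bound d A M ->
  `|M x| <= A.
Proof.
move=> x0 x1 [c [cA ->]]; apply: le_trans cA.
apply: le_trans (ler_norm_sum _ _ _) _; apply: ler_sum => i _.
by rewrite normrM ler_piMr // ger0_norm ?exprn_ge0 // exprn_ile1.
Qed.

Definition qscale u n := (Num.sqrt (pq_int 1 u n))^-1.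

(** Strong induction through [qmomentS], with one constant for all orders up to [m]. The factor
    1/[n] = s^2 more than pays for the extra power of s, since s <= 1. *)
Lemma qmoment_bound m : exists C : R, 0 <= C /\
  forall u n, 0 < u -> u < 1 -> (0 < n)%N -> forall j, (j <= m)%N ->
  poly_bound j (C * qscale u n ^+ j) (qmoment u n j).
Proof.
elim: m => [|m [C [C0 IHm]]].
  exists 1; split=> // u n u0 u1 n0 j; rewrite leqn0 => /eqP ->; rewrite mulr1.
  by apply: poly_bound_ext poly_bound1 => x; rewrite qmoment0.
(* The first summand pays for the u-difference quotient, the second for the lower moments. *)
pose E := m%:R * C + \sum_(j < m) C *+ 'C(m, j).
have E0 : 0 <= E.
  by rewrite addr_ge0 ?mulr_ge0 // sumr_ge0 // => j _; rewrite mulrn_wge0.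
(* [C] covers the earlier orders; [E] is doubled because 1 - x has l1 norm 2. *)
exists (C + (E + E)); split=> [|u n u0 u1 n0 j].
  exact: addr_ge0 C0 (addr_ge0 E0 E0).
set s := qscale u n.
have N1 : 1 <= pq_int 1 u n by case: n n0 {s} => // n _; exact: (qint_ge1 u0 u1 n).
have N0 := lt_le_trans ltr01 N1.
have s2 : (pq_int 1 u n)^-1 = s ^+ 2 by rewrite /s /qscale exprVn sqr_sqrtr // ltW.
have s0 : 0 <= s by rewrite invr_ge0 sqrtr_ge0.
have s1 : s <= 1.
  by rewrite -(@ler_pXn2r _ 2) ?nnegrE // -s2 expr1n invf_le1.
have us : 1 - u <= s ^+ 2.
  by rewrite -s2; case: n n0 {s N1 N0 s2 s0 s1} => // n _; exact: subr1_le_invqint.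
rewrite leq_eqVlt => /orP[/eqP ->|]; last first.
  rewrite ltnS => jm; apply: poly_bound_le (IHm u n u0 u1 n0 j jm).
  by rewrite ler_wpM2r ?exprn_ge0 // lerDl (addr_ge0 E0 E0).
have bdiff := poly_bound_qdiff u0 u1 (IHm u n u0 u1 n0 m (leqnn m)).
have bsum : poly_bound m
    (\sum_(j < m) (s ^+ 2) ^+ (m - j).-1 * (C * s ^+ j) *+ 'C(m, j))
    (fun x => \sum_(j < m) (- x) ^+ (m - j) * (1 - u) ^+ (m - j).-1 *
       qmoment u n j (u * x) *+ 'C(m, j)).
  apply: (@poly_bound_sum m m
    (fun j => (s ^+ 2) ^+ (m - j).-1 * (C * s ^+ j) *+ 'C(m, j))
    (fun j x => (- x) ^+ (m - j) * (1 - u) ^+ (m - j).-1 *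
       qmoment u n j (u * x) *+ 'C(m, j))) => {}j jm.
  have := poly_bound_dilate u0 u1 (IHm u n u0 u1 n0 j (ltnW jm)).
  move=> /(poly_boundXn (m - j)).
  move=> /(poly_boundZ ((1 - u) ^+ (m - j).-1 *+ 'C(m, j))).
  rewrite subnK 1?ltnW //; have u1' : 0 <= 1 - u by rewrite subr_ge0 ltW.
  move=> H; apply: poly_bound_ext; last apply: poly_bound_le H.
    by move=> x /=; rewrite mulrnAl; congr (_ *+ _); ring.
  rewrite ger0_norm ?mulrn_wge0 ?exprn_ge0 // mulrnAl ler_wMn2r //.
  by rewrite ler_wpM2r ?mulr_ge0 ?exprn_ge0 // lerXn2r // nnegrE exprn_ge0.
have bS := poly_boundZ (s ^+ 2)
  (poly_boundD bdiff (poly_boundN bsum)).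
have bE : poly_bound m (E * s ^+ m.+1) (fun x => s ^+ 2 *
    ((qmoment u n m x - qmoment u n m (u * x)) / (1 - u) -
     \sum_(j < m) (- x) ^+ (m - j) * (1 - u) ^+ (m - j).-1 *
       qmoment u n j (u * x) *+ 'C(m, j))).
  apply: poly_bound_le bS; rewrite ger0_norm ?exprn_ge0 // mulrDr mulrDl.
  apply: lerD.
    rewrite [leLHS](_ : _ = m%:R * C * s ^+ (m.+1).+1); last by rewrite !exprS; ring.
    by rewrite ler_wpM2l ?mulr_ge0 // ler_wiXn2l.
  rewrite mulr_sumr mulr_suml; apply: ler_sum => -[{}j jm] _ /=.
  rewrite mulrnAr mulrnAl ler_wMn2r // -exprM mulrCA [leRHS]mulrC.
  (* The exponent equals 2m - j, which is at least m + 1 because j < m. *)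
  rewrite [leLHS](_ : _ = s ^+ (2 + 2 * (m - j).-1 + j) * C).
    rewrite ler_wpM2r // ler_wiXn2l //.
    by lia.
  by rewrite !exprD; ring.
have bEx := poly_boundX bE.
have := poly_boundD (poly_boundS bE) (poly_boundN bEx).
move=> /(@poly_bound_le _ _ ((C + (E + E)) * s ^+ m.+1)) H.
apply: poly_bound_ext (H _) => [x|].
  by rewrite qmomentS // s2; ring.
by rewrite -mulrDl ler_wpM2r ?exprn_ge0 // lerDr.
Qed.

End PolynomialBound.

(** * One-sided derivatives and Taylor's formula on [0, 1] *)

Section Taylor.
Local Open Scope classical_set_scope.
Local Open Scope ring_scope.
Context {R : realType}.
Implicit Types (f g : R -> R) (x y t : R).

Lemma derivable01_cvg f x : derivable01 f x ->
  diff_quotient f x @ within `[0, 1] x^' --> derive01 f x.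
Proof. by []. Qed.

Lemma derivable01_cvg_within f x : derivable01 f x ->
  f @ within `[0, 1] (nbhs x) --> f x.
Proof.
move=> /derivable01_cvg cf.
have FF : Filter (within `[0, 1] x^') by apply: within_filter.
have cx : (fun y => y - x) @ within `[0, 1] x^' --> x - x.
  apply: cvgB; last exact: cvg_cst.
  by do 2 apply: cvg_within_filter; exact: cvg_id.
have {cf cx} : (fun y => diff_quotient f x y * (y - x)) @ within `[0, 1] x^' -->
    (0 : R) by have := cvgM (FF := FF) cf cx; rewrite subrr mulr0.
move=> /(@cvgrPdist_lt _ _ _ _ FF) cfx; apply/cvgrPdist_lt => e e0; move: (cfx e e0).
rewrite /dnbhs !near_withinE => H; apply: filterS H => y H y01.
(* The quotient is controlled on a punctured neighbourhood only; the point [y = x] is trivial. *)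
have [->|yx] := eqVneq y x; first by rewrite subrr normr0.
move: (H yx y01); rewrite /diff_quotient /= divfK ?subr_eq0 //.
by rewrite sub0r normrN distrC.
Qed.

Lemma derivable01_continuous f : (forall x, x \in `[0, 1] -> derivable01 f x) ->
  {within `[0, 1], continuous f}.
Proof.
move=> df; apply/subspace_continuousP => x x01.
by apply: derivable01_cvg_within; exact: df.
Qed.

(** An interior point has a neighbourhood inside [0, 1], so the restricted limit is the ordinary
    one. The mean value theorem asks for derivatives at such points only. *)
Lemma is_derive01 f x : x \in `]0, 1[ -> derivable01 f x ->
  is_derive x 1 f (derive01 f x).
Proof.
move=> x01 /derivable01_cvg cf.
have {}cf : diff_quotient f x @ x^' --> derive01 f x.
  apply: cvg_trans cf; apply: cvg_app => A.
  rewrite /dnbhs /within /= => H; apply: filterS2 (near_in_itvoo x01) H.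
  move=> y y01 + yx => /(_ yx); apply.
  by move: y01; rewrite !in_itv /= => /andP[/ltW -> /ltW ->].
have cvgq : (fun h : R => h^-1 *: (f (h *: 1 + x) - f x)) @ 0^' --> derive01 f x.
  apply/cvgrPdist_lt => e e0; move/cvgrPdist_lt/(_ _ e0) : cf.
  rewrite /dnbhs !near_withinE !near_simpl -!nbhs_nearE.
  move=> /nbhs0P; apply: filterS => h /= + h0.
  rewrite /diff_quotient [_%:A]mulr1 (addrC x h) addrK.
  by rewrite /GRing.scale /= mulrC; apply; rewrite -subr_eq0 addrK.
by apply: DeriveDef; [apply/cvg_ex; exists (derive01 f x)|exact/cvg_lim].
Qed.

Definition taylor_remainder r f t x : R :=
  f x - \sum_(0 <= i < r.+1) (i`!%:R)^-1 * derive01n i f t * (x - t) ^+ i.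

Lemma derive01nSr i f : derive01n i.+1 f = derive01n i (derive01 f).
Proof. exact: iterSr. Qed.

Lemma taylor_remainderS r f t x : taylor_remainder r.+1 f t x =
  taylor_remainder r f t x - (r.+1`!%:R)^-1 * derive01n r.+1 f t * (x - t) ^+ r.+1.
Proof. by rewrite /taylor_remainder [in LHS]big_nat_recr //= opprD addrA. Qed.

Lemma is_derive_monomial t x i (c : R) :
  is_derive x 1 (fun y => c * (y - t) ^+ i.+1) (c * (i.+1%:R * (x - t) ^+ i)).
Proof.
have dx : is_derive x (1 : R) (fun y => y - t) 1.
  by rewrite -[X in is_derive _ _ _ X](subr0 1); apply: is_deriveB.
have -> : (fun y => c * (y - t) ^+ i.+1) = c *: (fun y => y - t) ^+ i.+1.
  by rewrite exprfctE.
apply: is_derive_eq (is_deriveZ c (is_deriveX i.+1 dx)) _.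
by rewrite /GRing.scale /= mulr1.
Qed.

Lemma taylor_remainder_continuous r f t : {within `[0, 1], continuous f} ->
  {within `[0, 1], continuous (taylor_remainder r f t)}.
Proof.
move=> /subspace_continuousP cf; apply/subspace_continuousP => x x01.
elim: r => [|r IHr].
  have -> : taylor_remainder 0 f t = fun y => f y - f t.
    apply/funext => y; rewrite /taylor_remainder big_nat1.
    by rewrite fact0 invr1 mul1r expr0 mulr1.
  by apply: cvgB; [exact: cf|exact: cvg_cst].
have -> : taylor_remainder r.+1 f t = fun y => taylor_remainder r f t y -
    (r.+1`!%:R)^-1 * derive01n r.+1 f t * (y - t) ^+ r.+1.
  by apply/funext => y; rewrite taylor_remainderS.
apply: cvgB => //; apply: cvg_within_filter.
have /derivable1_diffP /differentiable_continuous := @ex_derive _ _ _ _ _ _ _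
  (is_derive_monomial t x r ((r.+1`!%:R)^-1 * derive01n r.+1 f t)).
exact.
Qed.

(** Differentiation in [x] cancels one factor of each factorial and shifts the Taylor sum of [f] to
    that of its derivative. This drives the induction on the order below. *)
Lemma is_derive_taylor_remainder r f t x : x \in `]0, 1[ -> derivable01 f x ->
  is_derive x 1 (taylor_remainder r.+1 f t)
    (taylor_remainder r (derive01 f) t x).
Proof.
move=> x01 /(is_derive01 x01) df.
have dcst : is_derive x 1 (taylor_remainder 0 f t) (derive01 f x).
  have -> : taylor_remainder 0 f t = f - cst (f t).
    apply/funext => y; rewrite /taylor_remainder big_nat1.
    by rewrite fact0 invr1 mul1r expr0 mulr1.
  by rewrite -[X in is_derive _ _ _ X]subr0; apply: is_deriveB.
elim: r => [|r IHr].
  have -> : taylor_remainder 1 f t = taylor_remainder 0 f t -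
      (fun y => (1`!%:R)^-1 * derive01n 1 f t * (y - t) ^+ 1).
    by apply/funext => y; rewrite taylor_remainderS.
  apply: is_derive_eq (is_deriveB dcst
    (is_derive_monomial t x 0 ((1`!%:R)^-1 * derive01n 1 f t))) _.
  by rewrite /taylor_remainder big_nat1 !expr0 mul1r.
have -> : taylor_remainder r.+2 f t = taylor_remainder r.+1 f t -
    (fun y => (r.+2`!%:R)^-1 * derive01n r.+2 f t * (y - t) ^+ r.+2).
  by apply/funext => y; rewrite taylor_remainderS.
apply: is_derive_eq
  (is_deriveB IHr (is_derive_monomial t x r.+1 ((r.+2`!%:R)^-1 * derive01n r.+2 f t))) _.
rewrite taylor_remainderS derive01nSr; congr (_ - _).
rewrite (factS r.+1) natrM; field.
by rewrite pnatr_eq0 -lt0n fact_gt0 -natrD pnatr_eq0.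
Qed.

Lemma Cr01_derive01 r f : Cr01 r.+1 f -> Cr01 r (derive01 f).
Proof.
move=> [df cf]; split; last by rewrite -derive01nSr.
by move=> i ir x x01; rewrite -derive01nSr; apply: df.
Qed.

Lemma Cr01_derivable01 r f x : Cr01 r.+1 f -> x \in `[0, 1] -> derivable01 f x.
Proof. by move=> [df _] /(df 0) => /(_ isT). Qed.

(** Induction on [r]: the remainder vanishes at [t], and the mean value theorem expresses it through
    the lower remainder of f' at some c between [t] and [x]. The factor 1/r! is given up. *)
Lemma taylor_remainder_le r f t x W : Cr01 r f -> 0 <= t <= 1 -> 0 <= x <= 1 ->
  (forall s, 0 <= s <= 1 -> `|s - t| <= `|x - t| ->
     `|derive01n r f s - derive01n r f t| <= W) ->
  `|taylor_remainder r f t x| <= `|x - t| ^+ r * W.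
Proof.
elim: r f x => [|r IHr] f x Crf t01 x01 HW.
  rewrite mul1r /taylor_remainder big_nat1 fact0 invr1 mul1r expr0 mulr1.
  exact: HW.
have E0 : taylor_remainder r.+1 f t t = 0.
  rewrite /taylor_remainder big_nat_recl // fact0 invr1 mul1r expr0 mulr1.
  rewrite big1 => [|i _]; first by rewrite addr0 subrr.
  by rewrite subrr exprS mul0r mulr0.
have W0 : 0 <= W.
  by rewrite (le_trans _ (HW t t01 _)) // subrr normr0.
(* The oscillation bound [W] passes to every point no farther from [t] than [x]. *)
have IH s : 0 <= s <= 1 -> `|s - t| <= `|x - t| ->
    `|taylor_remainder r (derive01 f) t s| <= `|x - t| ^+ r * W.
  move=> s01 sx; apply: (le_trans (IHr _ _ (Cr01_derive01 Crf) t01 s01 _)).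
    move=> s' s'01 s's; have := HW s' s'01 (le_trans s's sx).
    by rewrite derive01nSr.
  by rewrite ler_wpM2r ?lerXn2r // ?nnegrE.
have cE : {within `[0, 1], continuous (taylor_remainder r.+1 f t)}.
  apply: taylor_remainder_continuous; apply: derivable01_continuous => y.
  exact: Cr01_derivable01 Crf.
have MVTab a b : 0 <= a -> a < b -> b <= 1 ->
    exists2 c, c \in `]a, b[ & taylor_remainder r.+1 f t b -
     taylor_remainder r.+1 f t a = taylor_remainder r (derive01 f) t c * (b - a).
  move=> a0 ab b1; apply: MVT => //.
    move=> c; rewrite in_itv /= => /andP[ac cb].
    have c01 : 0 < c < 1 by rewrite (le_lt_trans a0 ac) (lt_le_trans cb b1).
    apply: is_derive_taylor_remainder; first by rewrite in_itv.
    apply: Cr01_derivable01 Crf _.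
    by case/andP: c01 => *; rewrite in_itv /= !ltW.
  apply: continuous_subspaceW cE => c /=; rewrite !in_itv /= => /andP[ac cb].
  by rewrite (le_trans a0 ac) (le_trans cb b1).
have [xt|tx|->] := ltgtP x t; last by rewrite E0 normr0 subrr normr0 expr0n mul0r.
- have [] := MVTab x t; [lra|lra|lra|] => c /[!in_itv] /= cxt.
  rewrite E0 sub0r => /(congr1 Num.norm); rewrite normrN normrM => ->.
  rewrite exprSr -mulrA mulrCA mulrC (distrC t) ler_wpM2l //.
  by apply: IH; [lra|rewrite !ler0_norm; lra].
- have [] := MVTab t x; [lra|lra|lra|] => c /[!in_itv] /= cxt.
  rewrite E0 subr0 => ->.
  rewrite normrM exprSr -mulrA mulrCA mulrC ler_wpM2l //.
  by apply: IH; [lra|rewrite !ger0_norm; lra].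
Qed.

End Taylor.

(** * Growth of the modulus of continuity *)

Section Modulus.
Local Open Scope classical_set_scope.
Local Open Scope ring_scope.
Context {R : realType}.
Variable g : R -> R.
Hypothesis cg : {within `[0, 1], continuous g}.
Implicit Types x y t : R.

Lemma modulus_ub t x y : 0 <= x <= 1 -> 0 <= y <= 1 -> `|x - y| <= t ->
  `|g x - g y| <= modulus g t.
Proof.
move=> x01 y01 xyt; apply: ub_le_sup; last by exists x, y; rewrite !in_itv.
(* The extreme values of [g] bound the set, so [sup] is a true supremum. *)
have [M _ gM] := EVT_max ler01 cg; have [m _ gm] := EVT_min ler01 cg.
exists (g M - g m) => _ [a [b [a01 b01 _ ->]]].
by rewrite ler_distl; move: (gM a a01) (gM b b01) (gm a a01) (gm b b01); lra.
Qed.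

Lemma modulus_ge0 t : 0 <= t -> 0 <= modulus g t.
Proof.
move=> t0; apply: le_trans (@modulus_ub t 0 0 _ _ _) => //.
all: by rewrite ?subrr ?normr0 ?lexx ?ler01.
Qed.

Lemma modulus_le t t' : 0 <= t -> t <= t' -> modulus g t <= modulus g t'.
Proof.
move=> t0 tt'; apply: ge_sup.
  by exists `|g 0 - g 0|, 0, 0; rewrite !in_itv /= lexx ler01 subrr normr0.
move=> _ [x [y [+ + xyt ->]]]; rewrite !in_itv => x01 y01.
by apply: modulus_ub => //; exact: le_trans tt'.
Qed.

Lemma modulus_chain t m x y : 0 <= x <= 1 -> 0 <= y <= 1 ->
  `|x - y| <= m%:R * t -> `|g x - g y| <= m%:R * modulus g t.
Proof.
move=> + y01; elim: m x => [|m IHm] x x01.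
  rewrite mul0r normr_le0 subr_eq0 => /eqP ->.
  by rewrite subrr normr0 mul0r.
move=> xyt; have m0 : 0 < m.+1%:R :> R by rewrite ltr0n.
(* [z] ends the first of [m.+1] equal steps from [x] to [y]; the rest is left to the induction
   hypothesis. *)
pose a : R := m.+1%:R^-1; pose z := (1 - a) * x + a * y.
have a01 : 0 <= a <= 1 by rewrite invr_ge0 ltW //= invf_le1 // ler1n.
have am : a * m.+1%:R = 1 by rewrite mulVf // gt_eqF.
have z01 : 0 <= z <= 1 by rewrite /z; nra.
have xzt : `|x - z| <= t.
  have -> : x - z = a * (x - y) by rewrite /z; ring.
  rewrite normrM ger0_norm; last by lra.
  by rewrite -[leRHS]mul1r -am -mulrA ler_wpM2l //; lra.
have zyt : `|z - y| <= m%:R * t.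
  have -> : z - y = (1 - a) * (x - y) by rewrite /z; ring.
  rewrite normrM ger0_norm; last by lra.
  rewrite [leRHS](_ : _ = (1 - a) * (m.+1%:R * t)); last first.
    by rewrite mulrA mulrBl am -natr1; ring.
  by rewrite ler_wpM2l //; lra.
rewrite -[g x](subrK (g z)) -addrA (le_trans (ler_normD _ _)) //.
rewrite -natr1 mulrDl mul1r [leRHS]addrC lerD //; last exact: IHm.
exact: modulus_ub.
Qed.

(** With m the integer part of |x - y| / t, a chain of m + 1 steps of length at most [t]
    suffices. *)
Lemma modulus_dilate t x y : 0 < t -> 0 <= x <= 1 -> 0 <= y <= 1 ->
  `|g x - g y| <= (1 + `|x - y| / t) * modulus g t.
Proof.
move=> t0 x01 y01.
have d0 : 0 <= `|x - y| / t by rewrite divr_ge0 // ltW.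
have := truncn_itv d0.
set m := Num.truncn _ => /andP[md dm].
apply: (le_trans (@modulus_chain t m.+1 x y x01 y01 _)).
  by rewrite -ler_pdivrMr // ltW.
by rewrite ler_wpM2r ?modulus_ge0 ?(ltW t0) // -natr1 [leLHS]addrC lerD2l.
Qed.

End Modulus.

(** * The error estimate for p = 1, then for general p *)

Section Estimate.
Context {R : realType}.
Variable u : R.
Hypotheses (u0 : 0 < u) (u1 : u < 1).

(** The weights sum to 1, so [f x] can be moved under the sum. *)
Lemma pq_bernsteinB r n f x : pq_bernstein r n 1 u f x - f x =
  - \sum_(0 <= k < n.+1) pq_basis n k 1 u x *
      taylor_remainder r f (pq_node n k 1 u) x.
Proof.
rewrite /pq_bernstein expr1n invr1 mul1r.
have -> : f x = \sum_(0 <= k < n.+1) f x * pq_basis n k 1 u x.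
  by rewrite -mulr_sumr (sum_qbasis u0 u1) mulr1.
rewrite -sumrB -sumrN.
by apply: eq_bigr => k _; rewrite /taylor_remainder mulrBr opprB (mulrC (f x)).
Qed.

Lemma qnode_ge0_le1 n k : (0 < n)%N -> (k <= n)%N ->
  0 <= pq_node n k 1 u <= 1.
Proof.
case: n => // n _ kn; rewrite qnodeE.
have N0 := lt_le_trans ltr01 (qint_ge1 u0 u1 n).
rewrite divr_ge0 ?(qint_ge0 u0 u1) //= ler_pdivrMr // mul1r.
exact: qint_le.
Qed.

(** The even order makes absolute moments coincide with the central moments already bounded. *)
Lemma normalized_moment_le n m (C : R) x : (0 < n)%N -> 0 <= x -> x <= 1 ->
  poly_bound m.*2 (C * qscale u n ^+ m.*2) (qmoment u n m.*2) ->
  \sum_(0 <= k < n.+1) pq_basis n k 1 u x *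
    (`|x - pq_node n k 1 u| / qscale u n) ^+ m.*2 <= C.
Proof.
move=> n0 x0 x1 /(poly_bound_norm_le x0 x1) bM.
have s0 : 0 < qscale u n.
  case: n n0 {bM} => // n _.
  by rewrite invr_gt0 sqrtr_gt0 (lt_le_trans ltr01 (qint_ge1 u0 u1 n)).
have -> : \sum_(0 <= k < n.+1) pq_basis n k 1 u x *
    (`|x - pq_node n k 1 u| / qscale u n) ^+ m.*2 =
    qmoment u n m.*2 x / qscale u n ^+ m.*2.
  rewrite mulr_suml; apply: eq_bigr => k _.
  by rewrite distrC expr_div_n -mul2n exprM real_normK ?num_real // -exprM mulrA.
by rewrite ler_pdivrMr ?exprn_gt0 // (le_trans (ler_norm _)).
Qed.

Lemma qbernstein_le r n (C : R) x f : (0 < n)%N -> 0 <= x -> x <= 1 ->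
  (forall j, (j <= r.+1.*2)%N ->
     poly_bound j (C * qscale u n ^+ j) (qmoment u n j)) ->
  Cr01 r f ->
  `|pq_bernstein r n 1 u f x - f x| <=
    (2 + (C + C)) * (qscale u n ^+ r * modulus (derive01n r f) (qscale u n)).
Proof.
move=> n0 x0 x1 bM Crf; have x01 : 0 <= x <= 1 by rewrite x0.
have [_ cg] := Crf.
set s := qscale u n; set g := derive01n r f.
have s0 : 0 < s.
  rewrite /s; case: n n0 {bM s} => // n _.
  by rewrite invr_gt0 sqrtr_gt0 (lt_le_trans ltr01 (qint_ge1 u0 u1 n)).
have om0 : 0 <= modulus g s by apply: modulus_ge0 => //; exact: ltW.
rewrite pq_bernsteinB normrN (le_trans (ler_norm_sum _ _ _)) //.
pose a k := `|x - pq_node n k 1 u| / s.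
have a0 k : 0 <= a k by rewrite divr_ge0 // ltW.
(* Summation turns the three terms in brackets into 2, [C] and [C], which is the constant
   claimed. *)
apply: (le_trans (y := \sum_(0 <= k < n.+1) (pq_basis n k 1 u x *
    (2 + (a k ^+ r.*2 + a k ^+ r.+1.*2))) * (s ^+ r * modulus g s))); last first.
  rewrite -mulr_suml ler_wpM2r ?mulr_ge0 ?exprn_ge0 ?(ltW s0) //.
  under eq_bigr do rewrite !mulrDr.
  rewrite !big_split /= -mulr_suml (sum_qbasis u0 u1) mul1r lerD2l.
  by apply: lerD; apply: normalized_moment_le => //; apply: bM;
    rewrite ?leq_double.
apply: ler_sum_nat => k /andP[_ kn]; rewrite ltnS in kn.
have t01 := qnode_ge0_le1 n0 kn.
rewrite normrM ger0_norm ?(qbasis_ge0 u0 u1) // -mulrA ler_wpM2l ?(qbasis_ge0 u0 u1) //.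
have := @taylor_remainder_le _ r f _ x ((1 + a k) * modulus g s) Crf t01 x01.
have W y : 0 <= y <= 1 -> `|y - pq_node n k 1 u| <= `|x - pq_node n k 1 u| ->
    `|g y - g (pq_node n k 1 u)| <= (1 + a k) * modulus g s.
  move=> y01 yx; apply: le_trans (modulus_dilate cg s0 y01 t01) _.
  by rewrite ler_wpM2r // lerD2l ler_wpM2r // invr_ge0 ltW.
move=> /(_ W) /le_trans -> //.
have -> : `|x - pq_node n k 1 u| = a k * s by rewrite divfK // gt_eqF.
rewrite exprMn [leLHS](_ : _ = (a k ^+ r * (1 + a k)) * (s ^+ r * modulus g s));
  last by ring.
rewrite ler_wpM2r ?mulr_ge0 ?exprn_ge0 ?(ltW s0) //.
rewrite mulrDr mulr1 -exprSr -!muln2 !exprM.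
(* By y <= y^2 + 1/4, powers of either parity are dominated by even ones. *)
move: (a k ^+ r) (a k ^+ r.+1) => y z.
have := sqr_ge0 (y - 2^-1); have := sqr_ge0 (z - 2^-1).
by lra.
Qed.

End Estimate.

Theorem theorem3p1 (R : realType) (r : nat) :
  exists D : R, 0 < D /\
    forall (p q : R), 0 < q -> q < p -> p <= 1 ->
    forall n : nat, (0 < n)%N ->
    forall x : R, 0 <= x -> x <= 1 ->
    forall f : R -> R, Cr01 r f ->
      `| pq_bernstein r n p q f x - f x | <=
        D * (pq_int p q n `^ (r%:R / 2))^-1 *
        modulus (derive01n r f) (Num.sqrt (pq_int p q n))^-1.
Proof.
(* The highest moment used has order 2r + 2. *)
have [C [C0 bM]] := @qmoment_bound R r.+1.*2.
exists (2 + (C + C)); split=> [|p q q0 qp p1 n n0 x x0 x1 f Crf].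
  by rewrite ltr_wpDr ?addr_ge0 // ltr0n.
have p0 : 0 < p := lt_trans q0 qp.
have pN0 : p != 0 by rewrite gt_eqF.
have pq0 : p - q != 0 by rewrite subr_eq0 gt_eqF.
have u0 : 0 < q / p by rewrite divr_gt0.
have u1 : q / p < 1 by rewrite ltr_pdivrMr // mul1r.
rewrite pq_bernstein_scale //.
apply: le_trans (qbernstein_le u0 u1 n0 x0 x1 (bM _ _ u0 u1 n0) Crf) _.
have [_ cg] := Crf.
have N1 : 1 <= pq_int 1 (q / p) n.
  by case: n n0 => // n _; exact: (qint_ge1 u0 u1).
have N0 : 0 < pq_int 1 (q / p) n := lt_le_trans ltr01 N1.
have M0 : 0 < pq_int p q n.
  by rewrite pq_int_scale // mulr_gt0 // divr_gt0 // exprn_gt0.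
(* The ratio is p^(n-1) <= 1, as [n] is positive. Hence the u-scale is the smaller one, and both s^r
   and the modulus increase with s. *)
have MN : pq_int p q n <= pq_int 1 (q / p) n.
  rewrite pq_int_scale // ler_piMl ?(ltW N0) // ler_pdivrMr // mul1r.
  by case: n n0 {M0 N0 N1} => // n _; rewrite exprS ler_piMr ?exprn_ile1 // ltW.
have sM : qscale (q / p) n <= (Num.sqrt (pq_int p q n))^-1.
  by rewrite /qscale lef_pV2 ?posrE ?sqrtr_gt0 // ler_sqrt // ltW.
have s0 : 0 <= qscale (q / p) n by rewrite invr_ge0 sqrtr_ge0.
rewrite -[leRHS]mulrA.
have -> : (pq_int p q n `^ (r%:R / 2))^-1 = (Num.sqrt (pq_int p q n))^-1 ^+ r.
  by rewrite mulrC powRrM powR12_sqrt ?(ltW M0) // powR_mulrn ?sqrtr_ge0 // exprVn.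
rewrite ler_wpM2l ?addr_ge0 // ler_pM ?exprn_ge0 ?modulus_ge0 //.
  by rewrite lerXn2r // nnegrE (le_trans s0).
exact: modulus_le.
Qed.
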